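(* For every integer $n\geq 2$, the Schultz index of the pentagonal Möbius chain $P'_n$ is \[\operatorname{Sc}(P'_n)=\begin{cases}35n^3+48n^2-10n, & n \text{ even},\\ 35n^3+48n^2-11n, & n \text{ odd}.\end{cases}\]
   Context: For $n\geq 2$, $P'_n$ has vertex set $\{u_1,\dots,u_{2n}\}\cup\{u'_1,\dots,u'_{2n}\}\cup\{w_1,\dots,w_n\}$ and edges $u_ku_{k+1}$, $u'_ku'_{k+1}$ ($1\le k\le 2n-1$), $u_{2n}u'_1$, $u'_{2n}u_1$, $u_{2k-1}u'_{2k-1}$ ($1\le k\le n$), and $u_{2k}w_k$, $w_ku'_{2k}$ ($1\le k\le n$). For a connected graph with vertices $v_1,\dots,v_N$, degrees $d_i$ and shortest-path distances $d_{ij}$, the Schultz index is $\operatorname{Sc}(G)=\frac12\sum_{i=1}^N\sum_{j=1}^N (d_i+d_j)d_{ij}$. *)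

(* Defs.v *)
From mathcomp Require Import all_boot all_order all_algebra.

Set Implicit Arguments.
Unset Strict Implicit.
Unset Printing Implicit Defensive.

Import GRing.Theory.

Local Open Scope nat_scope.

(* A finite simple graph on the vertex type T is given by its adjacency
   relation e : rel T, which is meant to be symmetric and irreflexive. *)
Section Graph.

Variables (T : finType) (e : rel T).

Definition degree (x : T) : nat := #|[set y | e x y]|.

Definition walk (k : nat) (x y : T) : bool :=
  [exists p : k.-tuple T, path e x p && (last x p == y)].

(* A shortest path visits each vertex at most once, so its length is < #|T|;
   gdist x y has the junk value #|T| when x and y are not connected. *)
Definition gdist (x y : T) : nat :=
  find (fun k => walk k x y) (iota 0 #|T|).

Lemma gdistP (x y : T) : connect e x y ->
  walk (gdist x y) x y /\ (forall k, walk k x y -> gdist x y <= k).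
Proof.
move=> /connectP[p0 e_p0 def_y].
move: def_y; have [p e_p uniq_p _] := shortenP e_p0; move=> def_y.
set a := (fun k => walk k x y).
have lt_p : size p < #|T|.
  by rewrite -[(size p).+1]/(size (x :: p)) -(card_uniqP uniq_p) max_card.
have walk_p : a (size p).
  by apply/existsP; exists (in_tuple p); rewrite /= e_p def_y eqxx.
have has_a : has a (iota 0 #|T|).
  by apply/hasP; exists (size p) => //; rewrite mem_iota.
have lt_d : gdist x y < #|T| by rewrite -[X in _ < X](size_iota 0) -has_find.
split.
  by have := nth_find 0 has_a; rewrite nth_iota.
move=> k walk_k; rewrite leqNgt; apply/negP => lt_k.
have := before_find 0 lt_k; rewrite nth_iota ?add0n; last exact: ltn_trans lt_d.
by rewrite /a walk_k.
Qed.

Local Open Scope ring_scope.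

Definition schultz : rat :=
  2%:R^-1 * \sum_(x : T) \sum_(y : T) (degree x + degree y)%N%:R * (gdist x y)%:R.

End Graph.

(* Indices are 0-based: for k >= 1, the vertices u_k, u'_k, w_k are U (k - 1),
   U' (k - 1), W (k - 1).  In particular u_{2k-1} is the U vertex
   of even index 2(k-1), and u_{2k} the one of odd index 2(k-1)+1. *)
Definition pmc_vertex (n : nat) : finType :=
  ('I_(2 * n) + 'I_(2 * n) + 'I_n)%type.

Local Notation U i := (inl (inl i)) (only parsing).
Local Notation U' i := (inl (inr i)) (only parsing).
Local Notation W i := (inr i) (only parsing).

(* Each edge listed once, in one orientation. *)
Definition pmc_arc (n : nat) (x y : pmc_vertex n) : bool :=
  match x, y with
  | U i, U j => j == i.+1 :> nat
  | U' i, U' j => j == i.+1 :> nat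
  | U i, U' j =>
      [&& i == (2 * n).-1 :> nat & j == 0 :> nat] || (* u_{2n} u'_1 *)
      [&& i == j & ~~ odd i]                         (* u_{2k-1} u'_{2k-1} *)
  | U' i, U j => [&& i == (2 * n).-1 :> nat & j == 0 :> nat] (* u'_{2n} u_1 *)
  | U i, W k => i == (2 * k).+1 :> nat
  | W k, U' j => j == (2 * k).+1 :> nat
  | _, _ => false
  end.

Definition pentagonal_moebius_chain (n : nat) : rel (pmc_vertex n) :=
  fun x y => pmc_arc x y || pmc_arc y x.

Lemma pmc_sym n : symmetric (@pentagonal_moebius_chain n).
Proof. by move=> x y; apply: orbC. Qed.

Lemma pmc_irrefl n : irreflexive (@pentagonal_moebius_chain n).
Proof.
rewrite /pentagonal_moebius_chain => -[[i|i]|k] /=; rewrite ?orbb //.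
  by rewrite eqn_leq ltnn andbF.
by rewrite eqn_leq ltnn andbF.
Qed.

Lemma pmc_connected n (x y : pmc_vertex n) :
  connect (@pentagonal_moebius_chain n) x y.
Proof.
have csym : connect_sym (@pentagonal_moebius_chain n) := sym_connect_sym (@pmc_sym n).
suff H z : exists i0 : 'I_(2 * n), i0 = 0 :> nat /\
    connect (@pentagonal_moebius_chain n) (U i0) z.
  have [i [i0 ci]] := H x; have [j [j0 cj]] := H y.
  have eij : i = j by apply: val_inj; rewrite /= i0 j0.
  by rewrite eij csym in ci; apply: connect_trans cj.
have n2 : 0 < 2 * n.
  case: z => [[i|i]|k]; try exact: leq_ltn_trans (ltn_ord i).
  by rewrite muln_gt0 /=; apply: leq_ltn_trans (ltn_ord k).
exists (Ordinal n2); split=> //.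
have HU m (lt_m : m < 2 * n) :
    connect (@pentagonal_moebius_chain n) (U (Ordinal n2)) (U (Ordinal lt_m)).
  elim: m lt_m => [|m IHm] lt_m; first by rewrite (bool_irrelevance lt_m n2).
  apply: connect_trans (IHm (ltnW lt_m)) (connect1 _).
  by rewrite /pentagonal_moebius_chain /= eqxx.
have HU' m (lt_m : m < 2 * n) :
    connect (@pentagonal_moebius_chain n) (U (Ordinal n2)) (U' (Ordinal lt_m)).
  elim: m lt_m => [|m IHm] lt_m.
    rewrite (bool_irrelevance lt_m n2); apply: connect1.
    by rewrite /pentagonal_moebius_chain /= eqxx orbT.
  apply: connect_trans (IHm (ltnW lt_m)) (connect1 _).
  by rewrite /pentagonal_moebius_chain /= eqxx.
case: z => [[[i lt_i]|[i lt_i]]|k]; rewrite ?HU ?HU' //.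
have lt_k : (2 * k).+1 < 2 * n.
  by have := ltn_ord k; rewrite -(leq_pmul2l (ltn0Sn 1)) mulnS.
apply: connect_trans (HU _ lt_k) (connect1 _).
by rewrite /pentagonal_moebius_chain /= eqxx.
Qed.

(* Main.v *)
(* The vertices u_1, ..., u_2n, u'_1, ..., u'_2n form a cycle of length 4n, in
   which every vertex is linked to the opposite one, at distance 2n, by an edge
   or by a path of length two through some w_k.  A shortest path uses at most
   one such link, which gives the distances in closed form; they depend only
   on places along the cycle, and are justified by checking that they are
   1-Lipschitz along edges and decrease by one along some edge.  Every vertex
   sees its distances up to rotation, so each row sum reduces to a sum of a
   function of the place, whose values at the places i, n + i, 2n + i and
   3n + i have a sum independent of i > 0.  Degrees are 3 on the cycle and 2
   at the w_k; the parity of n only enters through the distances among the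
   w_k, which are governed by a cycle of length n. *)
Require Import Defs.
From mathcomp Require Import all_boot all_order all_algebra.
From mathcomp Require Import zify ring.
Import GRing.Theory.
Local Open Scope nat_scope.

(** * Certifying distances and degrees in a finite graph *)

(** Descending from [y] to [x] builds a walk of length [f y], which also gives connectedness.
    Conversely [f] grows by at most one per step from [f x = 0], so no walk to [y] is shorter. *)
Lemma gdist_eq (T : finType) (e : rel T) (x : T) (f : T -> nat) :
  f x = 0 ->
  (forall y z, e y z -> f z <= (f y).+1) ->
  (forall y, y != x -> exists2 z, e z y & f y = (f z).+1) ->
  forall y, gdist e x y = f y.
Proof.
move=> fx0 f_lip f_desc y.
have [p [e_p last_p size_p]] :
    exists p, [/\ path e x p, last x p = y & size p = f y].
  move: {2}(f y) (erefl (f y)) => m; elim: m y => [|m IHm] y fy.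
    have [->|/f_desc[z _]] := eqVneq y x; last by rewrite fy.
    by exists [::].
  have [yx|/f_desc[z e_zy]] := eqVneq y x; first by rewrite yx fx0 in fy.
  move=> fyz; have [|p [e_p last_p size_p]] := IHm z.
    by apply/succn_inj; rewrite -fyz.
  exists (rcons p y); split; last by rewrite size_rcons size_p.
    by rewrite rcons_path e_p last_p.
  by rewrite last_rcons.
have fle q u : path e u q -> f (last u q) <= f u + size q.
  elim: q u => [|v q IHq] u /=; first by rewrite addn0.
  by case/andP=> /f_lip uv /IHq /leq_trans; apply; rewrite addnS -addSn leq_add2r.
have walk_f : walk e (f y) x y.
  apply/existsP; exists (tcast size_p (in_tuple p)).
  by rewrite val_tcast /= e_p last_p eqxx.
have xy : connect e x y by apply/connectP; exists p.
have [/existsP[q /andP[e_q /eqP last_q]] gmin] := gdistP xy.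
apply/eqP; rewrite eqn_leq gmin //=.
by have := fle _ _ e_q; rewrite last_q fx0 size_tuple.
Qed.

Lemma degree_size (T : finType) (e : rel T) (x : T) (s : seq T) :
  uniq s -> (forall y, e x y = (y \in s)) -> degree e x = size s.
Proof.
move=> us es; rewrite /degree -(card_uniqP us).
by apply: eq_card => y; rewrite inE es.
Qed.

(** * Places along the cycle and sums over them *)

(** Numbers the [4 * n]-cycle in order from 0, so that consecutive places are adjacent and opposite
    ones differ by [2 * n]. *)
Definition pos {n} (z : 'I_(2 * n) + 'I_(2 * n)) : nat :=
  match z with inl i => i | inr i => 2 * n + i end.

Lemma pos_lt n (z : 'I_(2 * n) + 'I_(2 * n)) : pos z < 4 * n.
Proof. by case: z => i; have := ltn_ord i; rewrite /=; lia. Qed.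

Lemma pos_inj n : injective (@pos n).
Proof.
by move=> [] i [] j; have := ltn_ord i; have := ltn_ord j; rewrite /= => ? ? ?;
  try lia; congr (_ _); apply: val_inj => /=; lia.
Qed.

Lemma pos_surj n p : p < 4 * n ->
  exists z : 'I_(2 * n) + 'I_(2 * n), pos z = p.
Proof.
move=> hp; have [h|h] := ltnP p (2 * n); first by exists (inl (Ordinal h)).
have h' : p - 2 * n < 2 * n by lia.
by exists (inr (Ordinal h')) => /=; lia.
Qed.

Definition diffn (a b : nat) : nat := (a - b) + (b - a).

(** Recording the sign of the difference replaces truncated subtraction by an equation that can be
    substituted. *)
Variant apart (a b D : nat) : Prop :=
  ApartL of b = a + D | ApartR of a = b + D.

Lemma diffnP a b : apart a b (diffn a b).
Proof. by rewrite /diffn; have [h|h] := leqP a b; [left|right]; lia. Qed.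

Lemma sum_shift m a b (F : nat -> nat) :
  \sum_(a <= i < b) F (m + i) = \sum_(m + a <= p < m + b) F p.
Proof.
rewrite [m + a]addnC big_addn addnC addnK.
by apply: eq_bigr => i _; rewrite addnC.
Qed.

Lemma sum_quarters m (F : nat -> nat) :
  \sum_(0 <= p < 4 * m) F p =
  \sum_(0 <= i < m) (F i + F (m + i) + F (2 * m + i) + F (3 * m + i)).
Proof.
rewrite !big_split /= !sum_shift !addn0 -mulSnr addnn -mul2n -mulSnr.
by rewrite -!big_cat_nat // ?leq_mul2r ?orbT // -{1}[m]mul1n leq_mul2r orbT.
Qed.

(* Moving [q] to [q.+1] moves the last term, [h (N - q.+1)], to the front. *)
Lemma sum_diffn N (h : nat -> nat) q : q < N ->
  (forall D, 0 < D < N -> h (N - D) = h D) ->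
  \sum_(0 <= p < N) h (diffn q p) = \sum_(0 <= p < N) h p.
Proof.
case: N => // N hq h_sym; elim: q hq => [_|q IHq hq].
  by apply: eq_big_nat => p _; rewrite /diffn subn0 sub0n.
rewrite -IHq ?(ltnW hq) // big_nat_recl // [RHS]big_nat_recr //= addnC.
congr (_ + _).
by rewrite -[LHS]h_sym; [congr h|]; rewrite /diffn; lia.
Qed.

Lemma sum_pos m (F : nat -> nat) :
  \sum_(z : 'I_(2 * m) + 'I_(2 * m)) F (pos z) = \sum_(0 <= p < 4 * m) F p.
Proof.
rewrite big_sumType /= -(big_mkord xpredT F).
rewrite -(big_mkord xpredT (fun i => F (2 * m + i))) sum_shift addn0.
by rewrite -big_cat_nat ?leq_addr //=; congr bigop; congr index_iota; lia.
Qed.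

Lemma sum_odd m : \sum_(0 <= p < 2 * m) odd p = m.
Proof.
elim: m => [|m IHm]; first by rewrite big_geq.
by rewrite mulnS !addSn add0n !big_nat_recr //= IHm; lia.
Qed.

(** * Adjacency in terms of places *)

Section Moebius.
Variable n : nat.
Hypothesis hn : 2 <= n.

Local Notation e := (@pentagonal_moebius_chain n).
Local Notation C z := (inl z : pmc_vertex n).
Local Notation W k := (inr k : pmc_vertex n).

Definition cyc_adj (a b : nat) : bool :=
  [|| b == a.+1, a == b.+1, (a == 0) && (b == (4 * n).-1),
      (b == 0) && (a == (4 * n).-1) |
      ~~ odd a && ((b == a + 2 * n) || (a == b + 2 * n))].

Lemma adjCC z t : e (C z) (C t) = cyc_adj (pos z) (pos t).
Proof.
rewrite /pentagonal_moebius_chain /cyc_adj.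
by case: z => i; case: t => j; have := ltn_ord i; have := ltn_ord j;
  rewrite /= -?val_eqE /= => hi hj; lia.
Qed.

(** These two places are opposite on the cycle; they are called the feet of [W k] below. *)
Definition spoke_adj (a k : nat) : bool :=
  (a == (2 * k).+1) || (a == 2 * n + (2 * k).+1).

Lemma adjCW z k : e (C z) (W k) = spoke_adj (pos z) k.
Proof.
rewrite /pentagonal_moebius_chain /spoke_adj.
by case: z => i; have := ltn_ord i; have := ltn_ord k; rewrite /=; lia.
Qed.

Lemma adjWC z k : e (W k) (C z) = spoke_adj (pos z) k.
Proof. by rewrite pmc_sym adjCW. Qed.

Lemma adjWW k l : e (W k) (W l) = false.
Proof. by []. Qed.

Variant cyc_adj_spec (a b : nat) : Prop :=
  | CycAdj1 of b = a.+1
  | CycAdj2 of a = b.+1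
  | CycAdj3 of a = 0 & b = (4 * n).-1
  | CycAdj4 of b = 0 & a = (4 * n).-1
  | CycAdj5 of ~~ odd a & b = a + 2 * n
  | CycAdj6 of ~~ odd b & a = b + 2 * n.

Lemma cyc_adjP a b : cyc_adj a b -> cyc_adj_spec a b.
Proof.
case/or4P => [/eqP|/eqP|/andP[/eqP ? /eqP]|/orP[/andP[/eqP ? /eqP]|]].
- exact: CycAdj1.
- exact: CycAdj2.
- exact: CycAdj3.
- exact: CycAdj4.
case/andP=> a_even /orP[] /eqP ab; first exact: CycAdj5.
by apply: CycAdj6 => //; rewrite ab oddD oddM addbF in a_even.
Qed.

(** * Closed forms for the distances *)

(* [D] is the difference of two places, [c] their distance along the cycle.
   The detour to a link costs [2 * n - c] steps; it can be chosen so as to use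
   an edge, unless the endpoints are opposite and of odd place. *)
Definition profCC (o : bool) (D : nat) : nat :=
  let c := minn D (4 * n - D) in
  minn c (2 * n - c + 1 + (o && (D == 2 * n))).

(** Here [D] is measured from one foot, so [c] and [2 * n - c] are the cycle distances to the two
    feet; the successor counts the spoke edge. *)
Definition profWC (D : nat) : nat :=
  let c := minn D (4 * n - D) in (minn c (2 * n - c)).+1.

(** Two steps are spent on spoke edges. An index shift of one is two steps on the cycle, and since
    feet come in opposite pairs the indices behave as on a cycle of length [n]. *)
Definition profWW (D : nat) : nat :=
  if D == 0 then 0 else (2 * minn D (n - D)).+2.

Lemma profCC1 o D : D <= n -> profCC o D = D.
Proof. by rewrite /profCC; lia. Qed.

Lemma profCC2 o D : n < D -> D < 2 * n -> profCC o D = 2 * n + 1 - D.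
Proof. by rewrite /profCC; lia. Qed.

Lemma profCC3 o : profCC o (2 * n) = 1 + o.
Proof. by rewrite /profCC eqxx andbT; lia. Qed.

Lemma profCC4 o D : 2 * n < D -> D < 3 * n -> profCC o D = D + 1 - 2 * n.
Proof. by rewrite /profCC; lia. Qed.

Lemma profCC5 o D : 3 * n <= D -> profCC o D = 4 * n - D.
Proof. by rewrite /profCC; lia. Qed.

Lemma profWC1 D : D <= n -> profWC D = D.+1.
Proof. by rewrite /profWC; lia. Qed.

Lemma profWC2 D : n <= D -> D < 2 * n -> profWC D = (2 * n - D).+1.
Proof. by rewrite /profWC; lia. Qed.

Lemma profWC3 D : 2 * n <= D -> D < 3 * n -> profWC D = (D - 2 * n).+1.
Proof. by rewrite /profWC; lia. Qed.

Lemma profWC4 D : 3 * n <= D -> D < 4 * n -> profWC D = (4 * n - D).+1.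
Proof. by rewrite /profWC; lia. Qed.

Definition distCC (a b : nat) : nat := profCC (odd a) (diffn a b).

Definition distWC (k b : nat) : nat := profWC (diffn (2 * k).+1 b).

Definition distWW (k l : nat) : nat := profWW (diffn k l).

Definition pmc_dist (x y : pmc_vertex n) : nat :=
  match x, y with
  | inl z, inl t => distCC (pos z) (pos t)
  | inl z, inr k | inr k, inl z => distWC k (pos z)
  | inr k, inr l => distWW k l
  end.

(** On each branch the distance is affine in [D], with no [minn] left, which reduces later
    comparisons to linear arithmetic. *)
Variant distCC_spec (a b : nat) : nat -> Prop :=
  | DistCC1 D of apart a b D & D <= n : distCC_spec a b D
  | DistCC2 D of apart a b D & n < D & D < 2 * n :
      distCC_spec a b (2 * n + 1 - D)
  | DistCC3 of apart a b (2 * n) : distCC_spec a b (1 + odd a)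
  | DistCC4 D of apart a b D & 2 * n < D & D < 3 * n :
      distCC_spec a b (D + 1 - 2 * n)
  | DistCC5 D of apart a b D & 3 * n <= D & D < 4 * n :
      distCC_spec a b (4 * n - D).

Lemma distCCP a b : a < 4 * n -> b < 4 * n -> distCC_spec a b (distCC a b).
Proof.
move=> ha hb; have := diffnP a b.
have : diffn a b < 4 * n by rewrite /diffn; lia.
rewrite /distCC; move: (diffn a b) => D D4 aD.
have [h1|h1] := leqP D n; first by rewrite profCC1 //; apply: DistCC1.
have [h2|h2|h2] := ltngtP D (2 * n).
- by rewrite profCC2 //; apply: DistCC2.
- have [h3|h3] := ltnP D (3 * n).
    by rewrite profCC4 //; apply: DistCC4.
  by rewrite profCC5 //; apply: DistCC5.
by rewrite h2 profCC3; apply: DistCC3; rewrite -h2.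
Qed.

Variant distWC_spec (k b : nat) : nat -> Prop :=
  | DistWC1 D of apart (2 * k).+1 b D & D <= n : distWC_spec k b D.+1
  | DistWC2 D of apart (2 * k).+1 b D & n < D & D < 2 * n :
      distWC_spec k b (2 * n - D).+1
  | DistWC3 D of apart (2 * k).+1 b D & 2 * n <= D & D < 3 * n :
      distWC_spec k b (D - 2 * n).+1
  | DistWC4 D of apart (2 * k).+1 b D & 3 * n <= D & D < 4 * n :
      distWC_spec k b (4 * n - D).+1.

Lemma distWCP k b : k < n -> b < 4 * n -> distWC_spec k b (distWC k b).
Proof.
move=> hk hb; have := diffnP (2 * k).+1 b.
have : diffn (2 * k).+1 b < 4 * n by rewrite /diffn; lia.
rewrite /distWC; move: (diffn _ b) => D D4 aD.
have [h1|h1] := leqP D n; first by rewrite profWC1 //; apply: DistWC1.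
have [h2|h2] := ltnP D (2 * n).
  by rewrite profWC2 ?(ltnW h1) //; apply: DistWC2.
have [h3|h3] := ltnP D (3 * n).
  by rewrite profWC3 //; apply: DistWC3.
by rewrite profWC4 //; apply: DistWC4.
Qed.

Variant distWW_spec (k l : nat) : nat -> Prop :=
  | DistWW0 of k = l : distWW_spec k l 0
  | DistWW1 D of apart k l D & 0 < D & 2 * D <= n : distWW_spec k l (2 * D).+2
  | DistWW2 D of apart k l D & n < 2 * D & D < n :
      distWW_spec k l (2 * (n - D)).+2.

Lemma distWWP k l : k < n -> l < n -> distWW_spec k l (distWW k l).
Proof.
move=> hk hl; have := diffnP k l.
have : diffn k l < n by rewrite /diffn; lia.
rewrite /distWW; move: (diffn k l) => D Dn kD.
rewrite /profWW; have [D0|D0] := eqVneq D 0.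
  by apply: DistWW0; case: kD; lia.
have [h|h] := leqP (2 * D) n.
  have -> : minn D (n - D) = D by lia.
  by apply: DistWW1 => //; lia.
have -> : minn D (n - D) = n - D by lia.
exact: DistWW2.
Qed.

(** * The closed forms are 1-Lipschitz along edges *)

Ltac lia_apart := intros; repeat match goal with
  | H : apart _ _ _ |- _ => case: H => ? end; subst; lia.

Lemma distCC_lip a b c : a < 4 * n -> b < 4 * n -> c < 4 * n ->
  cyc_adj b c -> distCC a c <= (distCC a b).+1.
Proof.
move=> ha hb hc /cyc_adjP bc.
by case: (distCCP _ _ ha hc); case: (distCCP _ _ ha hb); case: bc; lia_apart.
Qed.

Lemma distWC_lip k b c : k < n -> b < 4 * n -> c < 4 * n ->
  cyc_adj b c -> distWC k c <= (distWC k b).+1.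
Proof.
move=> hk hb hc /cyc_adjP bc.
by case: (distWCP _ _ hk hb); case: (distWCP _ _ hk hc); case: bc; lia_apart.
Qed.

(** The two inequalities are the Lipschitz condition for the two directions of a spoke edge. *)
Lemma distCW_lip a b k : a < 4 * n -> b < 4 * n -> k < n ->
  spoke_adj b k -> distWC k a <= (distCC a b).+1 /\ distCC a b <= (distWC k a).+1.
Proof.
move=> ha hb hk /orP bk.
by case: (distWCP _ _ hk ha); case: (distCCP _ _ ha hb); case: bk => /eqP; lia_apart.
Qed.

Lemma distWW_lip b k l : b < 4 * n -> k < n -> l < n ->
  spoke_adj b l -> distWW k l <= (distWC k b).+1 /\ distWC k b <= (distWW k l).+1.
Proof.
move=> hb hk hl /orP bl.
by case: (distWCP _ _ hk hb); case: (distWWP _ _ hk hl); case: bl => /eqP; lia_apart.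
Qed.

(** * The closed forms decrease along some edge *)

Lemma cyc_adj_next b : b < 4 * n -> exists c, [/\ c < 4 * n, cyc_adj c b &
  c = b.+1 \/ b = (4 * n).-1 /\ c = 0].
Proof.
move=> hb; have [h|h] := eqVneq b (4 * n).-1.
  by exists 0; rewrite /cyc_adj; split; lia.
by exists b.+1; rewrite /cyc_adj; split; lia.
Qed.

Lemma cyc_adj_prev b : b < 4 * n -> exists c, [/\ c < 4 * n, cyc_adj c b &
  b = c.+1 \/ c = (4 * n).-1 /\ b = 0].
Proof.
move=> hb; have [h|h] := eqVneq b 0.
  by exists (4 * n).-1; rewrite /cyc_adj; split; lia.
by exists b.-1; rewrite /cyc_adj; split; lia.
Qed.

Lemma cyc_adj_opp b : b < 4 * n -> ~~ odd b -> exists c, [/\ c < 4 * n,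
  cyc_adj c b & c = b + 2 * n \/ b = c + 2 * n].
Proof.
move=> hb b_even; have [h|h] := ltnP b (2 * n).
  by exists (b + 2 * n); rewrite /cyc_adj; split; lia.
by exists (b - 2 * n); rewrite /cyc_adj; split; lia.
Qed.

Lemma spoke_adj_odd b : b < 4 * n -> odd b -> exists2 k, k < n & spoke_adj b k.
Proof.
move=> hb b_odd; rewrite /spoke_adj; have [h|h] := ltnP b (2 * n).
  by exists b./2; lia.
by exists (b - 2 * n)./2; lia.
Qed.

Lemma distCC_desc a b : a < 4 * n -> b < 4 * n -> b != a ->
  (exists2 c, c < 4 * n /\ cyc_adj c b & distCC a b = (distCC a c).+1) \/
  (exists2 k, k < n /\ spoke_adj b k & distCC a b = (distWC k a).+1).
Proof.
move=> ha hb ba.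
(* [next], [prev] and [opp] each supply a neighbour of [b], so that the branches below only choose
   one and check the decrease there. *)
pose good d := exists2 c, c < 4 * n /\ cyc_adj c b & d = (distCC a c).+1.
have next : (forall c, c < 4 * n -> c = b.+1 \/ b = (4 * n).-1 /\ c = 0 ->
    distCC a b = (distCC a c).+1) -> good (distCC a b).
  by have [c [hc cb Ec]] := cyc_adj_next b hb; move/(_ c hc Ec); exists c.
have prev : (forall c, c < 4 * n -> b = c.+1 \/ c = (4 * n).-1 /\ b = 0 ->
    distCC a b = (distCC a c).+1) -> good (distCC a b).
  by have [c [hc cb Ec]] := cyc_adj_prev b hb; move/(_ c hc Ec); exists c.
have opp : ~~ odd b -> (forall c, c < 4 * n -> c = b + 2 * n \/ b = c + 2 * n ->
    distCC a b = (distCC a c).+1) -> good (distCC a b).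
  move=> b_even; have [c [hc cb Ec]] := cyc_adj_opp b hb b_even.
  by move/(_ c hc Ec); exists c.
move: next prev opp; case: (distCCP _ _ ha hb).
- move=> D [ab|ab] hD next prev _; left; [apply: prev | apply: next] => c hc Ec.
    by case: (distCCP _ _ ha hc); lia_apart.
  by case: (distCCP _ _ ha hc); lia_apart.
- move=> D ab h1 h2 next prev opp; left.
  (* Past a quarter turn, the descent moves on towards the place opposite [a]. One step before it,
     an even [b] means that [a] is odd and has no chord, so the chord at [b] is taken instead. *)
  have [/andP[b_even /eqP hD]|hbD] := boolP (~~ odd b && (D.+1 == 2 * n)).
    by apply: opp => // c hc Ec; case: (distCCP _ _ ha hc); lia_apart.
  case: ab => ab; [apply: next | apply: prev] => c hc Ec.
    by case: (distCCP _ _ ha hc); lia_apart.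
  by case: (distCCP _ _ ha hc); lia_apart.
(* Opposite places of odd parity are joined only through the [W] vertex having both as feet. *)
- move=> ab _ _ opp; have [b_odd|b_even] := boolP (odd b).
    have [k hk bk] := spoke_adj_odd b hb b_odd.
    right; exists k => //; move/orP: bk => bk.
    by case: (distWCP _ _ hk ha); case: bk => /eqP; lia_apart.
  by left; apply: opp => // c hc Ec; case: (distCCP _ _ ha hc); lia_apart.
- move=> D ab h1 h2 next prev opp; left.
  have [/andP[b_even /eqP hD]|hbD] := boolP (~~ odd b && (D == (2 * n).+1)).
    by apply: opp => // c hc Ec; case: (distCCP _ _ ha hc); lia_apart.
  case: ab => ab; [apply: prev | apply: next] => c hc Ec.
    by case: (distCCP _ _ ha hc); lia_apart.
  by case: (distCCP _ _ ha hc); lia_apart.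
- move=> D [ab|ab] h1 h2 next prev _; left; [apply: next | apply: prev] => c hc Ec.
    by case: (distCCP _ _ ha hc); lia_apart.
  by case: (distCCP _ _ ha hc); lia_apart.
Qed.

Lemma distCW_desc a k : a < 4 * n -> k < n ->
  exists2 b, b < 4 * n /\ spoke_adj b k & distWC k a = (distCC a b).+1.
Proof.
move=> ha hk; rewrite /spoke_adj.
have hb : (2 * k).+1 < 4 * n by lia.
have hb' : 2 * n + (2 * k).+1 < 4 * n by lia.
(* The witness is the foot nearer to [a]: [(2 * k).+1] within a quarter turn, its opposite
   otherwise. *)
case: (distWCP _ _ hk ha).
- by exists (2 * k).+1; first lia; case: (distCCP _ _ ha hb); lia_apart.
- by exists (2 * n + (2 * k).+1); first lia; case: (distCCP _ _ ha hb'); lia_apart.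
- by exists (2 * n + (2 * k).+1); first lia; case: (distCCP _ _ ha hb'); lia_apart.
- by exists (2 * k).+1; first lia; case: (distCCP _ _ ha hb); lia_apart.
Qed.

(** Both ends of a chord are equally far from [W k], whose feet are opposite, so the descent only
    walks along the cycle to the nearer foot. *)
Lemma distWC_desc k b : k < n -> b < 4 * n ->
  (exists2 c, c < 4 * n /\ cyc_adj c b & distWC k b = (distWC k c).+1) \/
  spoke_adj b k /\ distWC k b = 1.
Proof.
move=> hk hb; rewrite /spoke_adj.
pose good d := exists2 c, c < 4 * n /\ cyc_adj c b & d = (distWC k c).+1.
have next : (forall c, c < 4 * n -> c = b.+1 \/ b = (4 * n).-1 /\ c = 0 ->
    distWC k b = (distWC k c).+1) -> good (distWC k b).
  by have [c [hc cb Ec]] := cyc_adj_next b hb; move/(_ c hc Ec); exists c.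
have prev : (forall c, c < 4 * n -> b = c.+1 \/ c = (4 * n).-1 /\ b = 0 ->
    distWC k b = (distWC k c).+1) -> good (distWC k b).
  by have [c [hc cb Ec]] := cyc_adj_prev b hb; move/(_ c hc Ec); exists c.
have [bk|far] := boolP ((b == (2 * k).+1) || (b == 2 * n + (2 * k).+1)).
  right; split=> //; move/orP: bk => bk.
  by case: (distWCP _ _ hk hb); case: bk => /eqP; lia_apart.
left; move: next prev; case: (distWCP _ _ hk hb).
- move=> D [ab|ab] h next prev; [apply: prev | apply: next] => c hc Ec.
    by case: (distWCP _ _ hk hc); lia_apart.
  by case: (distWCP _ _ hk hc); lia_apart.
- move=> D [ab|ab] h h' next prev; [apply: next | apply: prev] => c hc Ec.
    by case: (distWCP _ _ hk hc); lia_apart.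
  by case: (distWCP _ _ hk hc); lia_apart.
- move=> D [ab|ab] h h' next prev; [apply: prev | apply: next] => c hc Ec.
    by case: (distWCP _ _ hk hc); lia_apart.
  by case: (distWCP _ _ hk hc); lia_apart.
- move=> D [ab|ab] h h' next prev; [apply: next | apply: prev] => c hc Ec.
    by case: (distWCP _ _ hk hc); lia_apart.
  by case: (distWCP _ _ hk hc); lia_apart.
Qed.

Lemma distWW_desc k l : k < n -> l < n -> l != k ->
  exists2 b, b < 4 * n /\ spoke_adj b l & distWW k l = (distWC k b).+1.
Proof.
move=> hk hl lk; have hb : (2 * l).+1 < 4 * n by lia.
(* Either foot of [W l] would do, as [distWC k] is unchanged by a half turn. *)
exists (2 * l).+1; first by rewrite /spoke_adj eqxx.
by case: (distWWP _ _ hk hl); case: (distWCP _ _ hk hb); lia_apart.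
Qed.

Lemma gdist_pmc x y : gdist e x y = pmc_dist x y.
Proof.
apply: gdist_eq y => [|y t|y].
- by case: x => [z|k] /=; rewrite /distCC /distWW /diffn subnn // /profCC !min0n.
- case: x => [z|k]; case: y => [y|l]; case: t => [t|m].
  + by rewrite adjCC /= => h; apply: distCC_lip; rewrite ?pos_lt.
  + by rewrite adjCW /= => /distCW_lip h; case: (h (pos z)); rewrite ?pos_lt.
  + by rewrite adjWC /= => /distCW_lip h; case: (h (pos z)); rewrite ?pos_lt.
  + by rewrite adjWW.
  + by rewrite adjCC /= => h; apply: distWC_lip; rewrite ?pos_lt.
  + by rewrite adjCW /= => /distWW_lip h; case: (h k); rewrite ?pos_lt.
  + by rewrite adjWC /= => /distWW_lip h; case: (h k); rewrite ?pos_lt.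
  + by rewrite adjWW.
case: x => [z|k]; case: y => [y|l].
- move=> yz; have yz' : pos y != pos z.
    by apply: contraNneq yz => /pos_inj ->.
  have [[c [hc cb] E]|[k [hk bk] E]] := distCC_desc _ _ (pos_lt n z) (pos_lt n y) yz'.
    have [t Et] := pos_surj _ _ hc; exists (C t); first by rewrite adjCC Et.
    by rewrite /= Et.
  by exists (W (Ordinal hk)); rewrite ?adjWC.
- move=> _; have [b [hb bl] E] := distCW_desc _ _ (pos_lt n z) (ltn_ord l).
  have [t Et] := pos_surj _ _ hb; exists (C t); first by rewrite adjCW Et.
  by rewrite /= Et.
- move=> _; have [[c [hc cb] E]|[ky E]] := distWC_desc _ _ (ltn_ord k) (pos_lt n y).
    have [t Et] := pos_surj _ _ hc; exists (C t); first by rewrite adjCC Et.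
    by rewrite /= Et.
  exists (W k); first by rewrite adjWC.
  by rewrite /= E /distWW /diffn subnn.
move=> lk; have [b [hb bl] E] := distWW_desc _ _ (ltn_ord k) (ltn_ord l) lk.
have [t Et] := pos_surj _ _ hb; exists (C t); first by rewrite adjCW Et.
by rewrite /= Et.
Qed.

(** * Degrees *)

(** Naming the cyclic successor [c] and predecessor [c'] absorbs the wrap-around, leaving an
    explicit list of neighbours for [degree_size]. *)
Lemma cyc_adjE b p c c' : b < 4 * n -> p < 4 * n -> c < 4 * n ->
  c = b.+1 \/ b = (4 * n).-1 /\ c = 0 ->
  b = c'.+1 \/ c' = (4 * n).-1 /\ b = 0 ->
  cyc_adj b p = [|| p == c, p == c' |
    ~~ odd b && ((p == b + 2 * n) || (b == p + 2 * n))].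
Proof.
move=> hb hp hc [Ec|[Eb Ec]] [Ec'|[Ec' Eb']]; rewrite /cyc_adj; subst.
all: lia.
Qed.
Lemma degreeC z : degree e (C z) = 3.
Proof.
have hz := pos_lt n z.
have [c [hc zc Ec]] := cyc_adj_next _ hz; have [t Et] := pos_surj _ _ hc.
have [c' [hc' zc' Ec']] := cyc_adj_prev _ hz; have [t' Et'] := pos_surj _ _ hc'.
have eqC (u v : 'I_(2 * n) + 'I_(2 * n)) : (C u == C v) = (pos u == pos v).
  by apply/eqP/eqP => [[->] //|/pos_inj ->].
have [z_odd|z_even] := boolP (odd (pos z)).
  have [k hk zk] := spoke_adj_odd _ hz z_odd.
  rewrite (@degree_size _ _ _ [:: C t; C t'; W (Ordinal hk)]) //.
    by rewrite /= !inE !eqC orbF; lia.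
  move=> [u|l]; rewrite !inE ?adjCC ?adjCW ?eqC.
    by rewrite orbF Et Et' (cyc_adjE (pos z) _ c c') ?pos_lt // z_odd /= orbF.
  rewrite /= -[_ == W _]/(l == Ordinal hk) -val_eqE /=.
  by have := ltn_ord l; move: zk; rewrite /spoke_adj; lia.
have [c'' [hc'' zc'' Ec'']] := cyc_adj_opp _ hz z_even.
have [t'' Et''] := pos_surj _ _ hc''.
rewrite (@degree_size _ _ _ [:: C t; C t'; C t'']) //.
  by rewrite /= !inE !eqC; lia.
move=> [u|l]; rewrite !inE ?adjCC ?adjCW ?eqC.
  rewrite Et Et' (cyc_adjE (pos z) _ c c') ?pos_lt // z_even /=.
  by have := pos_lt n u; lia.
have -> : spoke_adj (pos z) l = false by rewrite /spoke_adj; lia.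
by [].
Qed.

Lemma degreeW k : degree e (W k) = 2.
Proof.
have hk := ltn_ord k.
have [|t Et] := pos_surj n (2 * k).+1; first by lia.
have [|t' Et'] := pos_surj n (2 * n + (2 * k).+1); first by lia.
have eqC (u v : 'I_(2 * n) + 'I_(2 * n)) : (C u == C v) = (pos u == pos v).
  by apply/eqP/eqP => [[->] //|/pos_inj ->].
rewrite (@degree_size _ _ _ [:: C t; C t']) //.
  by rewrite /= !inE eqC; lia.
move=> [u|l]; rewrite !inE ?adjWC ?adjWW // ?eqC.
by rewrite /spoke_adj Et Et'.
Qed.

(** * Row sums of the distance matrix *)

(** For [i > 0] the four quarters give [i], [n + 1 - i], [i + 1] and [n - i]. At [i = 0] they give
    [0], [n], [1 + o] and [n], hence the corrections [1] and [o]. *)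
Lemma sum_profCC o :
  \sum_(0 <= D < 4 * n) profCC o D + 1 = n * (2 * n + 2) + o.
Proof.
rewrite sum_quarters big_ltn; last by lia.
rewrite (eq_big_nat _ _ (F2 := fun=> 2 * n + 2)); last first.
  by move=> i hi /=; rewrite (profCC1 _ i) ?(profCC2 _ (n + i))
    ?(profCC4 _ (2 * n + i)) ?(profCC5 _ (3 * n + i)); lia.
by rewrite !addn0 (profCC1 _ 0) // (profCC1 _ n) // profCC3 profCC5 // sum_nat_const_nat; nia.
Qed.

(** The quarters give alternately [i + 1] and [n - i + 1], this time also at [i = 0]. *)
Lemma sum_profWC : \sum_(0 <= D < 4 * n) profWC D = n * (2 * n + 4).
Proof.
rewrite sum_quarters (eq_big_nat _ _ (F2 := fun=> 2 * n + 4)); last first.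
  by move=> i hi /=; rewrite (profWC1 i) ?(profWC2 (n + i))
    ?(profWC3 (2 * n + i)) ?(profWC4 (3 * n + i)); lia.
by rewrite sum_nat_const_nat subn0.
Qed.

Lemma sum_profWW : 2 * \sum_(0 <= D < n) profWW D + 4 + odd n = n * (n + 4).
Proof.
have En := odd_double_half n; set m := n./2 in En.
have m_gt0 : 0 < m by lia.
(* Pairing [i] with [m + i], about half a turn of the cycle of length [n], makes the minima add up
   to [m] for even [n] and [m + 1] for odd [n]. *)
have profWW_pair i : odd n <= i -> i < odd n + m -> 0 < i ->
    profWW i + profWW (m + i) = 2 * m + 4 + 2 * odd n.
  by rewrite /profWW => ? ? ?; do 2 case: eqP => ?; lia.
(* For odd [n] the paired range starts at 1 and omits only [D = 0], where [profWW] vanishes. For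
   even [n] the pair at [i = 0] is exceptional and is split off later. *)
have -> : \sum_(0 <= D < n) profWW D =
    \sum_(odd n <= i < odd n + m) (profWW i + profWW (m + i)).
  rewrite big_split /=.
  have -> : \sum_(odd n <= i < odd n + m) profWW (m + i) =
      \sum_(odd n + m <= i < n) profWW i.
    by rewrite sum_shift (_ : m + (odd n + m) = n) 1?[m + _]addnC; lia.
  rewrite -big_cat_nat ?leq_addr //=; last by lia.
  case: (odd n) => //=; rewrite (@big_ltn _ _ _ 0) //; lia.
case: (odd n) En profWW_pair => /= En pair.
  rewrite (eq_big_nat _ _ (F2 := fun=> 2 * m + 6)); last first.
    by move=> i hi /=; rewrite pair; lia.
  by rewrite sum_nat_const_nat; nia.
rewrite big_ltn // (eq_big_nat _ _ (F2 := fun=> 2 * m + 4)); last first.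
  by move=> i hi /=; rewrite pair; lia.
have -> : profWW 0 + profWW (m + 0) = 2 * m + 2.
  by rewrite /profWW addn0 eqxx; case: eqP => ?; lia.
by rewrite sum_nat_const_nat; nia.
Qed.

Lemma row_distCC a : a < 4 * n ->
  \sum_(t : 'I_(2 * n) + 'I_(2 * n)) distCC a (pos t) + 1 =
  n * (2 * n + 2) + odd a.
Proof.
move=> ha; rewrite -sum_profCC (sum_pos n (distCC a)) /distCC.
by rewrite sum_diffn // => D hD; rewrite /profCC; lia.
Qed.

Lemma row_distWC k : k < n ->
  \sum_(t : 'I_(2 * n) + 'I_(2 * n)) distWC k (pos t) = n * (2 * n + 4).
Proof.
move=> hk; rewrite -sum_profWC (sum_pos n (distWC k)) /distWC.
by rewrite sum_diffn //; [lia|move=> D hD; rewrite /profWC; lia].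
Qed.

Lemma row_distWW k : k < n ->
  2 * \sum_(l < n) distWW k l + 4 + odd n = n * (n + 4).
Proof.
move=> hk; rewrite -sum_profWW -(big_mkord xpredT (distWW k)) /distWW.
rewrite sum_diffn // => D hD; rewrite /profWW; do 2 case: eqP => ?; lia.
Qed.

(** * Assembling the index *)

(** The double sum is twice the Schultz index; negative terms stand on the left to avoid truncated
    subtraction. *)
Lemma sum_degree_dist :
  \sum_x \sum_y (degree e x + degree e y) * gdist e x y + 20 * n + 2 * n * odd n
  = 70 * n ^ 3 + 96 * n ^ 2.
Proof.
pose SC := \sum_(z : 'I_(2 * n) + 'I_(2 * n))
  \sum_(t : 'I_(2 * n) + 'I_(2 * n)) distCC (pos z) (pos t).
pose SWC := \sum_(k < n) \sum_(t : 'I_(2 * n) + 'I_(2 * n)) distWC k (pos t).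
pose SW := \sum_(k < n) \sum_(l < n) distWW k l.
(* The weights are the degree sums [3 + 3], [3 + 2] and [2 + 2]; mixed pairs occur in both
   orders. *)
have -> : \sum_x \sum_y (degree e x + degree e y) * gdist e x y =
    6 * SC + 10 * SWC + 4 * SW.
  rewrite big_sumType /=.
  have -> : \sum_(z : 'I_(2 * n) + 'I_(2 * n))
      \sum_y (degree e (C z) + degree e y) * gdist e (C z) y = 6 * SC + 5 * SWC.
    rewrite /SWC [in RHS]exchange_big /= /SC !big_distrr -big_split /=.
    apply: eq_bigr => z _; rewrite big_sumType !big_distrr /=.
    congr (_ + _); apply: eq_bigr => y _;
      by rewrite gdist_pmc ?degreeC ?degreeW.
  have -> : \sum_(k < n) \sum_y (degree e (W k) + degree e y) * gdist e (W k) y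
      = 5 * SWC + 4 * SW.
    rewrite /SWC /SW !big_distrr -big_split /=.
    apply: eq_bigr => k _; rewrite big_sumType !big_distrr /=.
    congr (_ + _); apply: eq_bigr => y _;
      by rewrite gdist_pmc ?degreeC ?degreeW.
  lia.
(* The [4 * n] on the left collects the [+ 1] of each row; the final [2 * n] counts the odd
   places. *)
have hSC : SC + 4 * n = 4 * n * (n * (2 * n + 2)) + 2 * n.
  have -> : SC + 4 * n = \sum_(z : 'I_(2 * n) + 'I_(2 * n))
      (n * (2 * n + 2) + odd (pos z)).
    rewrite -(eq_bigr _ (fun z _ => row_distCC _ (pos_lt n z))) big_split /=.
    by rewrite sum1_card card_sum card_ord; congr addn; lia.
  rewrite (sum_pos n (fun p => n * (2 * n + 2) + odd p)) big_split /=.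
  rewrite sum_nat_const_nat subn0 (_ : 4 * n = 2 * (2 * n)) ?sum_odd; lia.
have hSWC : SWC = n * (n * (2 * n + 4)).
  rewrite /SWC (eq_bigr _ (fun k _ => row_distWC _ (ltn_ord k))).
  by rewrite sum_nat_const card_ord.
have hSW : 2 * SW + 4 * n + n * odd n = n * (n * (n + 4)).
  have -> : 2 * SW + 4 * n + n * odd n = \sum_(k < n) n * (n + 4).
    rewrite -(eq_bigr _ (fun k _ => row_distWW _ (ltn_ord k))) !big_split /=.
    by rewrite -/SW !sum_nat_const card_ord; lia.
  by rewrite sum_nat_const card_ord.
rewrite !expnS expn0; move: (odd n : nat) hSW => o hSW; nia.
Qed.

End Moebius.

Local Open Scope ring_scope.

Theorem theorem11 (n : nat) (hn : (2 <= n)%N) :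
  schultz (@pentagonal_moebius_chain n) =
    if odd n then 35%:R * n%:R ^+ 3 + 48%:R * n%:R ^+ 2 - 11%:R * n%:R
    else 35%:R * n%:R ^+ 3 + 48%:R * n%:R ^+ 2 - 10%:R * n%:R.
Proof.
pose e := @pentagonal_moebius_chain n.
pose total := (\sum_x \sum_y (degree e x + degree e y) * gdist e x y)%N.
have -> : schultz e = 2%:R^-1 * total%:R.
  rewrite /schultz natr_sum; congr (_ * _); apply: eq_bigr => x _.
  by rewrite natr_sum; apply: eq_bigr => y _; rewrite natrM.
(* Only the subtraction-free identity is cast to [rat]; subtracting and halving happen there. *)
have E : total%:R + 20%:R * n%:R + 2%:R * n%:R * (odd n)%:R =
    70%:R * n%:R ^+ 3 + 96%:R * n%:R ^+ 2 :> rat.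
  by rewrite -!natrX -!natrM -!natrD sum_degree_dist.
case: (odd n) E => /= E.
  have -> : total%:R = 70%:R * n%:R ^+ 3 + 96%:R * n%:R ^+ 2 - 22%:R * n%:R :> rat.
    by rewrite -E; ring.
  by field.
have -> : total%:R = 70%:R * n%:R ^+ 3 + 96%:R * n%:R ^+ 2 - 20%:R * n%:R :> rat.
  by rewrite -E; ring.
by field.
Qed.
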